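(* Let $t$ be a positive integer and let $G$ be a minimal counterexample to the following conjecture: every graph on $4t-1$ vertices with independence number $2$ satisfies $\mathrm{cm}(G)\ge t$. That is, $G$ has $4t-1$ vertices, $\alpha(G)=2$ and $\mathrm{cm}(G)\le t-1$, and the conjecture holds for every positive integer $t'<t$. Then for any disjoint subsets $S_1,S_2\subseteq V(G)$ (either of which may be empty) such that $G[S_1]$ and $G[S_2]$ are cliques and $S_1$ is anti-complete to $S_2$, we have $|S_1|+|S_2|\le t-4$.
   Context: All graphs are finite and simple. $\alpha(G)$ is the independence number. A matching $M$ in $G$ is connected if for every two edges of $M$ there is an edge of $G$ joining an endpoint of one to an endpoint of the other; $\mathrm{cm}(G)$ is the maximum size of a connected matching in $G$. Disjoint vertex sets $A,B$ are anti-complete if there is no edge between $A$ and $B$. $G[S]$ denotes the subgraph induced by $S$. *)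

(* Defs.v *)
From mathcomp Require Import all_boot all_order all_algebra.
Set Implicit Arguments. Unset Strict Implicit. Unset Printing Implicit Defensive.

Section Graphs.
Variables (T : finType) (e : rel T).

Definition simple_graph := symmetric e /\ irreflexive e.

Definition independent (S : {set T}) : bool :=
  [forall x in S, forall y in S, ~~ e x y].

Definition alpha : nat := \max_(S : {set T} | independent S) #|S|.

Definition clique (S : {set T}) : bool :=
  [forall x in S, forall y in S, (x != y) ==> e x y].

Definition anticomplete (A B : {set T}) : bool :=
  [forall x in A, forall y in B, ~~ e x y].

Definition is_edge (f : {set T}) : bool :=
  [exists u, exists v, [&& u != v, e u v & f == [set u; v]]].

Definition matching (M : {set {set T}}) : bool :=
  [forall f in M, is_edge f] &&
  [forall f in M, forall g in M, (f != g) ==> [disjoint f & g]].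

Definition connected_matching (M : {set {set T}}) : bool :=
  matching M &&
  [forall f in M, forall g in M, (f != g) ==> [exists u in f, exists v in g, e u v]].

Definition cm : nat := \max_(M : {set {set T}} | connected_matching M) #|M|.

End Graphs.

Definition conjecture (t : nat) : Prop :=
  forall (T : finType) (e : rel T), simple_graph e ->
    #|T| = 4 * t - 1 -> alpha e = 2 -> t <= cm e.

(* Main.v *)
Require Import Defs.
From mathcomp Require Import all_boot all_order all_algebra.
From mathcomp Require Import zify.
Set Implicit Arguments. Unset Strict Implicit. Unset Printing Implicit Defensive.

(* Take anticomplete cliques A, B with m = |A| + |B| maximum. Every vertex
   outside A and B is complete to A or to B. Let M be a connected matching
   avoiding A and B, and let Y be a set of m further vertices, each adjacent to
   every edge of M. By Hall's theorem A can be matched into the vertices of Y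
   complete to B and B into the rest of Y (or symmetrically), and this extends M
   by m edges: so cm >= |M| + m. If m > t - 4, such a Y exists for a suitable M:
   the empty matching if m >= t, any edge if m = t - 1, and otherwise one of the
   two perfect matchings of a hexagon inside a 6-clique, chosen so that few
   vertices are nonadjacent to one of its edges. For t <= 8 a clique of size
   t - 1 given by Ramsey's theorem settles the last case. *)

(** * Hall's marriage theorem *)

Definition nbrs (T : finType) (r : rel T) (A Y : {set T}) : {set T} :=
  [set y in Y | [exists a in A, r a y]].

(** Induction on [#|A|], after Halmos and Vaughan. A tight nonempty proper subset [B] is matched
    into its own neighbourhood and [A :\: B] into the rest of [Y]; if no such [B] exists, one vertex
    may take any of its neighbours. *)
Lemma hall_marriage (T : finType) (r : rel T) (A Y : {set T}) :
  (forall B : {set T}, B \subset A -> #|B| <= #|nbrs r B Y|) ->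
  exists f : T -> T,
    {in A &, injective f} /\ {in A, forall a, (f a \in Y) && r a (f a)}.
Proof.
have [n] := ubnP #|A|; elim: n A Y => // n IHn A Y ltAn hallA.
have [-> | [a aA]] := set_0Vmem A.
  by exists id; split=> [x y|x]; rewrite in_set0.
have nbrs1 x B : x \in nbrs r B Y -> x \in Y by rewrite inE => /andP[].
have [/existsP[B /and4P[sBA neqBA B0 tight]] | slack] :=
  boolP [exists B : {set T}, [&& B \subset A, B != A, B != set0 & #|nbrs r B Y| <= #|B|]].
  have prBA : B \proper A by rewrite properEneq neqBA.
  have ltBn : #|B| < n by apply: leq_trans (proper_card prBA) _.
  have ltCn : #|A :\: B| < n.
    have := cardsD A B; rewrite (setIidPr sBA).
    have : 0 < #|B| by rewrite card_gt0.
    have := subset_leq_card sBA; lia.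
  have [X sXB|f [injf fB]] := IHn B Y ltBn.
    by apply: hallA; apply: subset_trans sXB sBA.
  (* At least [#|X| + #|B|] vertices are neighbours of [X :|: B], and at most [#|B|] of them are
     neighbours of [B], so [X] keeps enough of its own. *)
  have [X sXC|g [injg gC]] := IHn (A :\: B) (Y :\: nbrs r B Y) ltCn.
    move: (sXC); rewrite subsetD => /andP[sXA dXB].
    have := hallA (X :|: B); rewrite subUset sXA sBA => /(_ isT).
    rewrite cardsU (disjoint_setI0 dXB) cards0 subn0 => le1.
    have sub : nbrs r (X :|: B) Y \subset nbrs r X (Y :\: nbrs r B Y) :|: nbrs r B Y.
      apply/subsetP => y; rewrite !inE => /andP[yY /existsP[x /andP[]]].
      rewrite yY inE => /orP[xX|xB] rxy.
        have -> : [exists a0 in X, r a0 y] by apply/existsP; exists x; rewrite xX.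
        by case: [exists a0 in B, r a0 y].
      have -> : [exists a0 in B, r a0 y] by apply/existsP; exists x; rewrite xB.
      by rewrite orbT.
    have := subset_leq_card sub; rewrite cardsU; lia.
  have fN x : x \in B -> f x \in nbrs r B Y.
    move=> xB; have /andP[fY rf] := fB x xB.
    by rewrite inE fY; apply/existsP; exists x; rewrite xB.
  have gN x : x \in A -> x \notin B -> g x \notin nbrs r B Y.
    move=> xA xB; have := gC x; rewrite inE xB xA => /(_ isT) /andP[].
    by rewrite inE => /andP[].
  exists (fun x => if x \in B then f x else g x); split=> [x y xA yA|x xA].
    case: ifPn => xB; case: ifPn => yB eqxy.
    - exact: injf.
    - by move: (gN y yA yB); rewrite -eqxy fN.
    - by move: (gN x xA xB); rewrite eqxy fN.
    - by apply: injg; rewrite // inE ?xB ?yB.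
  case: ifPn => xB; first exact: fB.
  have := gC x; rewrite inE xB xA => /(_ isT) /andP[].
  by rewrite inE => /andP[_ ->].
have /card_gt0P[y] : 0 < #|nbrs r [set a] Y|.
  by apply: leq_trans (hallA _ _); rewrite ?cards1 ?sub1set.
rewrite inE => /andP[yY /existsP[a' /andP[/set1P -> ray]]].
have ltDn : #|A :\ a| < n by rewrite (cardsD1 a A) aA in ltAn.
(* A nonempty [X] omitting [a] is proper in [A], hence not tight: it has a neighbour to spare and
   can afford to lose [y]. *)
have [X sXD|f [injf fD]] := IHn (A :\ a) (Y :\ y) ltDn.
  have [->|X0] := eqVneq X set0; first by rewrite cards0.
  move: (sXD); rewrite subsetD1 => /andP[sXA aX].
  have neqXA : X != A by apply: contraNneq aX => ->.
  move: slack; rewrite negb_exists => /forallP/(_ X).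
  rewrite sXA neqXA X0 /= -ltnNge => lt1.
  have sub : nbrs r X Y \subset y |: nbrs r X (Y :\ y).
    by apply/subsetP => z; rewrite !inE => /andP[-> ->]; case: eqP.
  have := subset_leq_card sub; rewrite cardsU1; lia.
exists (fun x => if x == a then y else f x); split=> [x z xA zA|x xA].
  have fy w : w \in A -> w != a -> f w != y.
    move=> wA wa; have := fD w; rewrite !inE wa wA => /(_ isT).
    by case/andP=> /andP[].
  case: eqP => [->|/eqP xa]; case: eqP => [->|/eqP za] // eqxz.
  - by have := fy z zA za; rewrite -eqxz eqxx.
  - by have := fy x xA xa; rewrite eqxz eqxx.
  - by apply: injf; rewrite // !inE ?xa ?za.
case: eqP => [->|/eqP xa]; first by rewrite yY.
have := fD x; rewrite !inE xa xA => /(_ isT) /andP[/andP[_ ->]].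
by [].
Qed.

(** * Connected matchings given by partner functions *)

Section Linked.
Variables (T : finType) (e : rel T).

Definition touch (x x' y y' : T) : bool :=
  [|| e x y, e x y', e x' y | e x' y'].

(** [D] holds one endpoint of each edge of a connected matching and [f] gives the other. This is the
    shape in which Hall's theorem delivers matchings. *)
Definition linked (D : {set T}) (f : T -> T) : Prop :=
  [/\ {in D &, injective f}, {in D, forall x, f x \notin D},
      {in D, forall x, e x (f x)} &
      {in D &, forall x y, x != y -> touch x (f x) y (f y)}].

(** Since [D] meets each edge in exactly one vertex, the edges [[set x; f x]] are distinct and
    number [#|D|]. *)
Lemma linked_cm (D : {set T}) (f : T -> T) :
  irreflexive e -> linked D f -> #|D| <= cm e.
Proof.
move=> irr [injf fD ef tf].
have injE : {in D &, injective (fun x => [set x; f x])}.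
  move=> x y xD yD eqE.
  have : x \in [set y; f y] by rewrite -eqE !inE eqxx.
  by case/set2P=> // xfy; have := fD y yD; rewrite -xfy xD.
rewrite -(card_in_imset injE); apply: leq_bigmax_cond.
apply/andP; split; [apply/andP; split|].
- apply/forallP => g; apply/implyP => /imsetP[x xD ->].
  apply/existsP; exists x; apply/existsP; exists (f x).
  rewrite ef ?eqxx // !andbT; apply: contraTneq (fD x xD) => <-.
  by rewrite xD.
- apply/forallP => g; apply/implyP => /imsetP[x xD ->].
  apply/forallP => h; apply/implyP => /imsetP[y yD ->].
  apply/implyP => neqxy.
  have {neqxy} xy : x != y by apply: contraNneq neqxy => ->.
  rewrite -setI_eq0; apply/eqP/setP => z; rewrite !inE.
  apply/negbTE; apply/negP => /andP[].
  case/orP=> /eqP -> /orP[] /eqP.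
  + by apply/eqP.
  + by move=> E; have := fD y yD; rewrite -E xD.
  + by move=> E; have := fD x xD; rewrite E yD.
  + by move/injf => E; rewrite E ?eqxx in xy.
apply/forallP => g; apply/implyP => /imsetP[x xD ->].
apply/forallP => h; apply/implyP => /imsetP[y yD ->].
apply/implyP => neqxy.
have {neqxy} xy : x != y by apply: contraNneq neqxy => ->.
have ex u v : u \in [set x; f x] -> v \in [set y; f y] -> e u v ->
    [exists u in [set x; f x], exists v in [set y; f y], e u v].
  move=> uE vE euv; apply/existsP; exists u; rewrite uE.
  by apply/existsP; exists v; rewrite vE.
have /or4P[] := tf x y xD yD xy; apply: ex; by rewrite !inE eqxx ?orbT.
Qed.

(** The last clause records where each partner comes from, so that the union can be combined with a
    third matching. *)
Lemma linkedU (D D' : {set T}) (f f' : T -> T) :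
  symmetric e -> linked D f -> linked D' f' ->
  [disjoint D & D'] ->
  {in D & D', forall x y, [/\ f x != y, x != f' y, f x != f' y & touch x (f x) y (f' y)]} ->
  exists g, linked (D :|: D') g /\
     {in D :|: D', forall x, (x \in D) && (g x == f x) || (x \in D') && (g x == f' x)}.
Proof.
move=> sym [injf fD ef tf] [injf' fD' ef' tf'] dD cross.
have nD' x : x \in D' -> (x \in D) = false.
  by move=> xD'; apply: contraTF xD' => xD; rewrite (disjointFr dD).
have g1 x : x \in D -> (if x \in D then f x else f' x) = f x by move=> ->.
have g2 x : x \in D' -> (if x \in D then f x else f' x) = f' x by move/nD' ->.
have touchC a b c d : touch a b c d -> touch c d a b.
  by rewrite /touch !(sym a) !(sym b) => /or4P[] ->; rewrite ?orbT.
exists (fun x => if x \in D then f x else f' x); split; last first.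
  move=> x; rewrite inE => /orP[xD|xD'].
    by rewrite xD eqxx.
  by rewrite nD' // xD' eqxx.
split=> [x y|x|x|x y].
- rewrite !inE => /orP[] xD /orP[] yD.
  + by rewrite (g1 x) // (g1 y) //; exact: injf.
  + rewrite (g1 x) // (g2 y) // => E.
    by have [_ _] := cross x y xD yD; rewrite E eqxx.
  + rewrite (g2 x) // (g1 y) // => E.
    by have [_ _] := cross y x yD xD; rewrite E eqxx.
  + by rewrite (g2 x) // (g2 y) //; exact: injf'.
- rewrite !inE => /orP[] xD.
    rewrite g1 // negb_or fD //=; apply/negP => xD'.
    by have [/eqP] := cross x (f x) xD xD'.
  rewrite g2 // negb_or fD' // andbT; apply/negP => xD'.
  by have [_ /eqP] := cross (f' x) x xD' xD.
- by rewrite !inE => /orP[] xD; [rewrite g1 // ef | rewrite g2 // ef'].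
- rewrite !inE => /orP[] xD /orP[] yD xy.
  + by rewrite (g1 x) // (g1 y) // tf.
  + by rewrite (g1 x) // (g2 y) //; have [] := cross x y xD yD.
  + by rewrite (g2 x) // (g1 y) //; apply: touchC; have [] := cross y x yD xD.
  + by rewrite (g2 x) // (g2 y) // tf'.
Qed.
End Linked.

(** * Cliques in graphs of independence number at most two *)

Section AlphaTwo.
Variables (T : finType) (e : rel T).
Hypotheses (sym : symmetric e) (irr : irreflexive e) (alpha2 : alpha e <= 2).

Lemma cliqueP (S : {set T}) :
  reflect {in S &, forall x y, x != y -> e x y} (clique e S).
Proof.
apply: (iffP 'forall_implyP) => [h x y xS yS xy | h x xS].
  by have /forall_inP/(_ y yS) := h x xS; rewrite xy.
by apply/forall_inP => y yS; apply/implyP; apply: h.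
Qed.

Lemma anticompleteP (A B : {set T}) :
  reflect {in A & B, forall x y, e x y = false} (anticomplete e A B).
Proof.
apply: (iffP 'forall_implyP) => [h x y xA yB | h x xA].
  by have /forall_inP/(_ y yB)/negbTE := h x xA.
by apply/forall_inP => y yB; rewrite h.
Qed.

Lemma alpha2_edge x y z : x != y -> x != z -> y != z ->
  e x y = false -> e x z = false -> e y z.
Proof.
move=> xy xz yz exy exz; apply: contraT => eyz.
suff : 2 < alpha e by rewrite ltnNge alpha2.
have <- : #|[set x; y; z]| = 3.
  by rewrite setUC cardsU1 cards2 !inE negb_or ![z == _]eq_sym xz yz xy.
apply: leq_bigmax_cond; apply/forall_inP => u; rewrite !inE => uE.
apply/forall_inP => v; rewrite !inE => vE.
by case/orP: uE => [/orP[]|] /eqP->; case/orP: vE => [/orP[]|] /eqP->;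
  rewrite ?irr ?exy ?exz ?(sym y x) ?(sym z x) ?(sym z y) ?exy ?exz.
Qed.

Lemma nonnbr_clique (x : T) (S : {set T}) :
  {in S, forall y, x != y /\ e x y = false} -> clique e S.
Proof.
move=> h; apply/cliqueP => y z yS zS yz.
by have [[xy exy] [xz exz]] := (h y yS, h z zS); apply: (alpha2_edge xy xz).
Qed.

(** The Ramsey bound R(3,k) <= k(k+1)/2, doubled to avoid division. The nonneighbours of a vertex
    form a clique; if they are too few, the induction continues among its neighbours. *)
Lemma ramsey3 (k : nat) (X : {set T}) :
  k * k.+1 <= #|X|.*2 -> exists2 Q : {set T}, Q \subset X & clique e Q /\ #|Q| = k.
Proof.
elim: k X => [|k IHk] X leX.
  exists set0; first exact: sub0set.
  by split; rewrite ?cards0 //; apply/cliqueP => x y; rewrite inE.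
have [v vX] : exists v, v \in X by apply/card_gt0P; lia.
pose W := [set y in X | (v != y) && ~~ e v y].
pose N := [set y in X | (v != y) && e v y].
have clW : clique e W.
  by apply: (@nonnbr_clique v) => y; rewrite inE => /and3P[_ -> /negbTE].
have cX : #|X| <= 1 + #|W| + #|N|.
  have sX : X \subset v |: W :|: N.
    apply/subsetP => y yX; rewrite !inE yX [v == y]eq_sym.
    by case: (y == v) => //=; case: (e v y).
  have := subset_leq_card sX; rewrite !cardsU cards1; lia.
have [ltkW | leWk] := ltnP k #|W|.
  have /card_gt0P[Q] : 0 < #|[set Q : {set T} | Q \subset W & #|Q| == k.+1]|.
    by rewrite cards_draws bin_gt0.
  rewrite inE => /andP[sQW /eqP cQ]; exists Q.
    by apply: subset_trans sQW _; apply/subsetP => y; rewrite inE => /andP[].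
  split=> //; apply/cliqueP => x y xQ yQ.
  by move/cliqueP: clW; apply; apply: (subsetP sQW).
(* Discarding [v] and at most [k] nonneighbours costs at most [k.+1] vertices, the gap between
   consecutive triangular numbers. *)
have [|Q sQN [clQ cQ]] := IHk N; first by nia.
have Nv y : y \in Q -> [/\ y \in X, v != y & e v y].
  by move/(subsetP sQN); rewrite inE => /and3P.
exists (v |: Q).
  by rewrite subUset sub1set vX; apply/subsetP => y /Nv[].
split; last first.
  rewrite cardsU1 cQ; have [/Nv[_]|//] := boolP (v \in Q).
  by rewrite eqxx.
apply/cliqueP => x y; rewrite !inE => /orP[/eqP->|xQ] /orP[/eqP->|yQ].
- by rewrite eqxx.
- by have [] := Nv y yQ.
- by have [] := Nv x xQ; rewrite sym.
- by move/cliqueP: clQ; apply.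
Qed.

Lemma clique_linked (C D : {set T}) (f : T -> T) :
  clique e C -> D \subset C -> {in D &, injective f} ->
  {in D, forall x, f x \in C :\: D} -> linked e D f.
Proof.
move=> /cliqueP clC /subsetP sDC injf fC.
have fx x : x \in D -> f x \in C /\ f x \notin D.
  by move/fC; rewrite inE => /andP[].
split=> // [x /fx[] //|x xD|x y xD yD xy].
  have [fxC fxD] := fx x xD; apply: clC => //; first exact: sDC.
  by apply: contraNneq fxD => <-.
by rewrite /touch clC //; apply: sDC.
Qed.

(** Any [t] vertices of [C] are adjacent to all the remaining ones, at least [t] in number, so
    Hall's condition is immediate. *)
Lemma large_clique_cm (t : nat) (C : {set T}) :
  clique e C -> t.*2 <= #|C| -> t <= cm e.
Proof.
move=> clC leC.
have /card_gt0P[D] : 0 < #|[set D : {set T} | D \subset C & #|D| == t]|.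
  by rewrite cards_draws bin_gt0; lia.
rewrite inE => /andP[sDC /eqP cD].
have [|f [injf fC]] := @hall_marriage T e D (C :\: D).
  move=> B sBD; have [->|[b bB]] := set_0Vmem B; first by rewrite cards0.
  have -> : nbrs e B (C :\: D) = C :\: D.
    apply/setP => y; rewrite inE; case: (boolP (y \in C :\: D)) => //= yCD.
    apply/existsP; exists b; rewrite bB; move: yCD; rewrite inE => /andP[yD yC].
    have bD := subsetP sBD b bB.
    move/cliqueP: clC; apply=> //; first exact: (subsetP sDC).
    by apply: contraNneq yD => <-.
  rewrite cardsD (setIidPr sDC); have := subset_leq_card sBD; lia.
rewrite -cD; apply: (@linked_cm _ _ D f) => //; apply: clique_linked clC sDC injf _.
by move=> x /fC/andP[].
Qed.

(** Edges starting at distinct vertices of a clique are always joined, so matching [t] vertices of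
    [C] into their complement suffices. A failure of Hall's condition produces a clique large enough
    for [large_clique_cm]. *)
Lemma clique_cm (t : nat) (C : {set T}) :
  4 * t - 1 <= #|T| -> clique e C -> t <= #|C| -> t <= cm e.
Proof.
move=> cT clC leC.
have /card_gt0P[D] : 0 < #|[set D : {set T} | D \subset C & #|D| == t]|.
  by rewrite cards_draws bin_gt0; lia.
rewrite inE => /andP[sDC /eqP cD].
have [/forall_inP h|] := boolP [forall (B : {set T} | B \subset D), #|B| <= #|nbrs e B (~: D)|].
  have [f [injf fD]] := hall_marriage h.
  rewrite -cD; apply: (@linked_cm _ _ D f) => //; split=> //.
  - by move=> x /fD/andP[]; rewrite inE.
  - by move=> x /fD/andP[].
  by move=> x y xD yD xy; move/cliqueP: clC => clC; rewrite /touch clC //; apply: (subsetP sDC).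
rewrite negb_forall_in => /existsP[B /andP[sBD]]; rewrite -ltnNge => ltB.
have [b bB] : exists b, b \in B by apply/card_gt0P; lia.
have sN : nbrs e B (~: D) \subset ~: D by apply/subsetP => x; rewrite inE => /andP[].
apply: (@large_clique_cm t (~: D :\: nbrs e B (~: D))).
  apply: (@nonnbr_clique b) => y; rewrite !inE => /andP[+ yD].
  rewrite yD negb_exists => /forallP/(_ b); rewrite bB => /negbTE.
  by split=> //; apply: contraNneq yD => <-; apply: (subsetP sBD).
(* Of the at least [3t - 1] vertices outside [D], at most [t - 1] are neighbours of [B], which
   leaves [2t]. *)
rewrite cardsD (setIidPr sN); have := cardsC D; have := subset_leq_card sBD; lia.
Qed.

(** * Anticomplete clique pairs of maximum total size, and matchings built on them *)

Definition clique_pair (A B : {set T}) : bool :=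
  [&& [disjoint A & B], clique e A, clique e B & anticomplete e A B].

Lemma clique_pairC (A B : {set T}) : clique_pair A B -> clique_pair B A.
Proof.
case/and4P=> dAB clA clB /anticompleteP acAB; rewrite /clique_pair disjoint_sym.
by rewrite dAB clA clB; apply/anticompleteP => x y xB yA; rewrite sym acAB.
Qed.

Definition maximum_pair (A B : {set T}) : Prop :=
  clique_pair A B /\
  forall A' B', clique_pair A' B' -> #|A'| + #|B'| <= #|A| + #|B|.

Lemma maximum_pairC (A B : {set T}) : maximum_pair A B -> maximum_pair B A.
Proof.
by case=> cAB maxAB; split=> [|A' B' /maxAB]; [apply: clique_pairC | rewrite [#|B| + _]addnC].
Qed.

(* A set X violating Hall's condition leaves a set W in Y anticomplete to X; as
   alpha <= 2, W :|: B is a clique, so (X, W :|: B) would beat (A, B). *)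
Lemma maximum_pair_matching (A B Y : {set T}) :
  maximum_pair A B -> [disjoint Y & A :|: B] -> #|A| <= #|Y| ->
  exists f : T -> T,
    {in A &, injective f} /\ {in A, forall a, (f a \in Y) && e a (f a)}.
Proof.
case=> /and4P[dAB /cliqueP clA /cliqueP clB /anticompleteP acAB] maxAB dY leAY.
apply: hall_marriage => X sXA; rewrite leqNgt; apply/negP => ltX.
have [a aX] : exists a, a \in X by apply/card_gt0P; lia.
have XA x : x \in X -> x \in A by apply: (subsetP sXA).
have YAB y : y \in Y -> y \notin A /\ y \notin B.
  by move=> yY; have := disjointFr dY yY; rewrite inE => /norP.
pose W := Y :\: nbrs e X Y.
have acW x y : x \in X -> y \in W -> e x y = false.
  rewrite !inE => xX /andP[+ yY]; rewrite yY negb_exists => /forallP/(_ x).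
  by rewrite xX => /negbTE.
have WY y : y \in W -> y \in Y by rewrite inE => /andP[].
have XB x y : x \in X -> y \in B -> (x != y) /\ e x y = false.
  move=> /XA xA yB; split; last exact: acAB.
  by apply/eqP => E; have := disjointFr dAB xA; rewrite E yB.
have XW x y : x \in X -> y \in W -> (x != y) /\ e x y = false.
  move=> xX yW; split; last exact: acW.
  by have [yA _] := YAB y (WY y yW); apply: contraNneq yA => <-; apply: XA.
have dWB : [disjoint W & B].
  by apply/pred0P => y /=; apply/negP => /andP[/WY/YAB[_ /negbTE->]].
have sN : nbrs e X Y \subset Y by apply/subsetP => x; rewrite inE => /andP[].
have := maxAB X (W :|: B).
have -> : clique_pair X (W :|: B).
  have XWB x y : x \in X -> y \in W :|: B -> (x != y) /\ e x y = false.
    by move=> xX; rewrite in_setU => /orP[]; [apply: XW | apply: XB].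
  apply/and4P; split.
  - apply/pred0P => y /=; apply/negP => /andP[yX yWB].
    by have [/eqP] := XWB y y yX yWB.
  - by apply/cliqueP => x y /XA xA /XA yA; apply: clA.
  - by apply: (@nonnbr_clique a) => y; apply: XWB.
  - by apply/anticompleteP => x y xX yW; have [] := XWB x y xX yW.
(* As [X] has fewer than [#|X|] neighbours in [Y], [#|X| + #|W|] exceeds [#|Y|], hence [#|A|]. *)
rewrite cardsU (disjoint_setI0 dWB) cards0 /W cardsD (setIidPr sN).
have := subset_leq_card sN; move=> leN /(_ isT); lia.
Qed.

(* The vertices matched to A are taken complete to B, so that each edge at A
   meets a neighbour of each edge at B. *)
Lemma maximum_pair_extend_asym (A B D Y : {set T}) (f : T -> T) :
  maximum_pair A B -> linked e D f ->
  {in D, forall x, x \notin A :|: B /\ f x \notin A :|: B} ->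
  {in Y, forall y, y \notin A :|: B} ->
  {in D & Y, forall x y, [/\ x != y, f x != y & e x y || e (f x) y]} ->
  #|A| <= #|[set y in Y | [forall b in B, e y b]]| -> #|A| + #|B| <= #|Y| ->
  #|D| + (#|A| + #|B|) <= cm e.
Proof.
move=> mAB lD Dout Yout DY leA leY.
have [cAB _] := mAB; have /and4P[dAB /cliqueP clA /cliqueP clB _] := cAB.
set YB := [set y in Y | _] in leA.
have [|g [injg gY]] := maximum_pair_matching mAB _ leA.
  by apply/pred0P => y /=; rewrite inE; apply/negP => /andP[/andP[/Yout/negP]].
have {gY} gA a : a \in A -> [/\ g a \in Y, e a (g a) & {in B, forall b, e (g a) b}].
  by move=> /gY/andP[]; rewrite inE => /andP[-> /forall_inP].
(* [B] is matched second and avoids the partners of [A]; at least [#|B|] vertices of [Y] are still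
   free. *)
have [||h [injh hY]] := @maximum_pair_matching B A (Y :\: g @: A) (maximum_pairC mAB).
- apply/pred0P => y /=; rewrite inE setUC; apply/negP => /andP[/andP[_ /Yout/negP]].
  by [].
- have : #|Y :&: g @: A| <= #|A|.
    by apply: leq_trans (subset_leq_card (subsetIr _ _)) (leq_imset_card _ _).
  by rewrite cardsD; lia.
have {hY} hB b : b \in B -> [/\ h b \in Y, e b (h b) & {in A, forall a, g a != h b}].
  move=> /hY/andP[]; rewrite inE => /andP[hg -> ->]; split=> // a aA.
  by apply: contraNneq hg => <-; apply: imset_f.
have YA y x : y \in Y -> x \in A -> (y == x) = false.
  by move=> /Yout; rewrite inE => /norP[yA _] xA; apply: contraNF yA => /eqP->.
have YB' y x : y \in Y -> x \in B -> (y == x) = false.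
  by move=> /Yout; rewrite inE => /norP[_ yB] xB; apply: contraNF yB => /eqP->.
have lA : linked e A g.
  split=> // [x /gA[/Yout]|x /gA[]//|x y xA yA xy]; first by rewrite inE => /norP[].
  by rewrite /touch clA.
have lB : linked e B h.
  split=> // [x /hB[/Yout]|x /hB[]//|x y xA yA xy]; first by rewrite inE => /norP[].
  by rewrite /touch clB.
have [|k [lk kE]] := linkedU sym lA lB dAB.
  move=> x y xA yB; have [gY _ gB] := gA x xA; have [hY _ hg] := hB y yB.
  by rewrite (YB' (g x)) // eq_sym (YA (h y)) // hg // /touch gB // !orbT.
have kY x : x \in A :|: B -> k x \in Y.
  case/kE/orP=> /andP[xA /eqP->]; first by have [] := gA x xA.
  by have [] := hB x xA.
have dD : [disjoint D & A :|: B].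
  by apply/pred0P => y /=; apply/negP => /andP[/Dout[/negP]].
have [|l [ll _]] := linkedU sym lD lk dD.
  move=> x y xD yAB; have [_ fxAB] := Dout x xD.
  have [xk fxk ek] := DY x (k y) xD (kY y yAB); rewrite xk fxk.
  split=> //; first by apply: contraNneq fxAB => ->.
  by rewrite /touch; case/orP: ek => ->; rewrite ?orbT.
have := linked_cm irr ll.
rewrite cardsU (disjoint_setI0 dD) cards0 cardsU (disjoint_setI0 dAB) cards0.
by rewrite !subn0.
Qed.

(** Each [y] in [Y] is complete to [A] or to [B], since otherwise [y] and one vertex of each would
    be independent. So [Y] has at least [#|A|] vertices complete to [B] or at least [#|B|] complete
    to [A]. *)
Lemma maximum_pair_extend (A B D Y : {set T}) (f : T -> T) :
  maximum_pair A B -> linked e D f ->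
  {in D, forall x, x \notin A :|: B /\ f x \notin A :|: B} ->
  {in Y, forall y, y \notin A :|: B} ->
  {in D & Y, forall x y, [/\ x != y, f x != y & e x y || e (f x) y]} ->
  #|A| + #|B| <= #|Y| ->
  #|D| + (#|A| + #|B|) <= cm e.
Proof.
move=> mAB lD Dout Yout DY leY.
have [leA|ltA] := leqP #|A| #|[set y in Y | [forall b in B, e y b]]|.
  exact: (maximum_pair_extend_asym mAB lD Dout Yout DY leA leY).
have [leB|ltB] := leqP #|B| #|[set y in Y | [forall b in A, e y b]]|.
  rewrite [#|A| + _]addnC; rewrite [A :|: B]setUC in Dout Yout.
  rewrite [#|A| + _]addnC in leY.
  exact: (maximum_pair_extend_asym (maximum_pairC mAB) lD Dout Yout DY leB leY).
have [/and4P[dAB _ _ /anticompleteP acAB] _] := mAB.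
set YB := [set y in Y | _] in ltA; set YA := [set y in Y | _] in ltB.
suff /subset_leq_card : Y \subset YB :|: YA by rewrite cardsU; lia.
apply/subsetP => y yY; rewrite !inE yY /=.
have [//|] := boolP [forall b in B, e y b].
rewrite negb_forall_in => /existsP[b /andP[bB /negbTE eyb]].
apply/forall_inP => a aA.
have := Yout y yY; rewrite inE => /norP[yA yB].
have ba : b != a by apply/eqP => E; have := disjointFr dAB aA; rewrite -E bB.
have yb : b != y by apply: contraNneq yB => <-.
have ya : y != a by apply: contraNneq yA => ->.
by apply: (alpha2_edge yb ba ya); rewrite sym // acAB.
Qed.
End AlphaTwo.

(** * Lower bounds on [cm] from a maximum pair *)

Section LargePairs.
Variables (T : finType) (e : rel T).
Hypotheses (sym : symmetric e) (irr : irreflexive e) (alpha2 : alpha e <= 2).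

(** The last clause keeps the prescribed pairing visible, because two pairings of the same six
    vertices are compared later. *)
Lemma linked3 (C : {set T}) (a a' b b' c c' : T) :
  clique e C -> uniq [:: a; a'; b; b'; c; c'] ->
  {subset [:: a; a'; b; b'; c; c'] <= C} ->
  exists D f, [/\ linked e D f, #|D| = 3 &
    {in D, forall x, (x, f x) \in [:: (a, a'); (b, b'); (c, c')]}].
Proof.
move=> clC U sC; pose f x := if x == a then a' else if x == b then b' else c'.
move: (U); rewrite /= !inE !negb_or -!andbA.
(* Six distinct vertices give 15 inequalities. *)
do 15![case/andP; let h := fresh "n" in intros h]; move=> _.
have nba : b == a = false by rewrite eq_sym; apply/negbTE.
have nca : c == a = false by rewrite eq_sym; apply/negbTE.
have ncb : c == b = false by rewrite eq_sym; apply/negbTE.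
have fa : f a = a' by rewrite /f eqxx.
have fb : f b = b' by rewrite /f nba eqxx.
have fc : f c = c' by rewrite /f nca ncb.
have inD x : x \in [set a; b; c] -> [\/ x = a, x = b | x = c].
  by rewrite !inE -orbA => /or3P[] /eqP ->; [constructor 1|constructor 2|constructor 3].
exists [set a; b; c], f; split.
- apply: (clique_linked clC).
  + by apply/subsetP => x /inD[] ->; apply: sC; rewrite !inE eqxx ?orbT.
  + move=> x y /inD[] -> /inD[] ->; rewrite ?fa ?fb ?fc // => E; exfalso;
    by move: E; apply/eqP; rewrite // eq_sym.
  + move=> x /inD[] ->; rewrite ?fa ?fb ?fc in_setD !inE !negb_or sC ?inE ?eqxx ?orbT // andbT;
    rewrite -!andbA; apply/and3P; split=> //; by rewrite eq_sym.
- by rewrite setUC cardsU1 cards2 !inE negb_or nca ncb eq_sym nba.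
- by move=> x /inD[] ->; rewrite ?fa ?fb ?fc !inE eqxx ?orbT.
Qed.

(** The nonneighbours of [u] form a clique, which competes with the maximum pair when paired with
    [[set u]]. *)
Lemma card_nonnbrs (A B Z : {set T}) (u : T) :
  maximum_pair e A B -> u \notin Z ->
  #|[set y in Z | ~~ e u y]| < #|A| + #|B|.
Proof.
case=> _ maxAB uZ; set N := [set y in Z | _].
have Nu : {in N, forall y, u != y /\ e u y = false}.
  move=> y; rewrite inE => /andP[yZ /negbTE ->]; split=> //.
  by apply: contraNneq uZ => ->.
have := maxAB [set u] N; rewrite cards1 add1n; apply.
apply/and4P; split.
- apply/pred0P => y /=; rewrite inE; apply/negP => /andP[/eqP-> /Nu[]].
  by rewrite eqxx.
- by apply/cliqueP => x y /set1P-> /set1P->; rewrite eqxx.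
- exact: (nonnbr_clique sym irr alpha2 Nu).
- by apply/anticompleteP => x y /set1P-> /Nu[].
Qed.

Lemma card_common_nonnbrs (A B Z : {set T}) (u v : T) :
  maximum_pair e A B -> u != v -> e u v -> u \notin Z -> v \notin Z ->
  #|[set y in Z | ~~ e u y && ~~ e v y]| + 2 <= #|A| + #|B|.
Proof.
case=> _ maxAB uv euv uZ vZ; set N := [set y in Z | _].
have Nu : {in N, forall y, [/\ u != y, v != y, e u y = false & e v y = false]}.
  move=> y; rewrite inE => /and3P[yZ /negbTE -> /negbTE ->]; split=> //.
    by apply: contraNneq uZ => ->.
  by apply: contraNneq vZ => ->.
have := maxAB [set u; v] N; rewrite cards2 uv addnC; apply.
apply/and4P; split.
- apply/pred0P => y /=; rewrite inE; apply/negP => /andP[+ /Nu[]].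
  by rewrite !inE ![y == _]eq_sym => /orP[] ->.
- by apply/cliqueP => x y /set2P[]-> /set2P[]->; rewrite ?eqxx // sym.
- by apply: (nonnbr_clique sym irr alpha2 (x := u)) => y /Nu[].
- by apply/anticompleteP => x y /set2P[]-> /Nu[].
Qed.

Lemma maximum_pair_cm (A B : {set T}) :
  maximum_pair e A B -> (#|A| + #|B|).*2 <= #|T| -> #|A| + #|B| <= cm e.
Proof.
move=> mAB leT; have [/and4P[dAB _ _ _] _] := mAB.
have l0 : linked e set0 id by split=> x; rewrite ?inE // => y; rewrite inE.
rewrite -[X in X <= _]add0n -(cards0 T).
refine (maximum_pair_extend sym irr alpha2 mAB l0 (Y := ~: (A :|: B)) _ _ _ _).
- by move=> x; rewrite inE.
- by move=> y; rewrite inE.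
- by move=> x y; rewrite inE.
- have := cardsC (A :|: B); rewrite cardsU (disjoint_setI0 dAB) cards0; lia.
Qed.

(** Three vertices outside the pair contain an edge [uv]. With m = [#|A| + #|B|], at most m - 2
    vertices of [Z] miss both ends, so at least [#|T|] - 2m >= m remain for [Y]. *)
Lemma maximum_pair_cm1 (A B : {set T}) :
  maximum_pair e A B -> 3 * (#|A| + #|B|) <= #|T| -> 3 + #|A| + #|B| <= #|T| ->
  (#|A| + #|B|).+1 <= cm e.
Proof.
move=> mAB leT leT3; have [/and4P[dAB _ _ _] _] := mAB.
have cAB : #|A :|: B| = #|A| + #|B|.
  by rewrite cardsU (disjoint_setI0 dAB) cards0 subn0.
have cR := cardsC (A :|: B).
have [|Q sQ [/cliqueP clQ cQ]] :=
  ramsey3 sym irr alpha2 (k := 2) (X := ~: (A :|: B)); first by lia.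
have /cards2P[u [v [uv defQ]]] : #|Q| == 2 by rewrite cQ.
have uQ : u \in Q by rewrite defQ set21.
have vQ : v \in Q by rewrite defQ set22.
have euv : e u v by apply: clQ.
pose Z := ~: (A :|: B) :\: [set u; v].
have uZ : u \notin Z by rewrite !inE eqxx.
have vZ : v \notin Z by rewrite !inE eqxx orbT.
have leN := card_common_nonnbrs mAB uv euv uZ vZ.
set N := [set y in Z | _] in leN.
have l1 : linked e [set u] (fun=> v).
  split=> [x y /set1P-> /set1P->|x _|x /set1P->|x y /set1P-> /set1P->] //.
    by rewrite inE eq_sym.
  by rewrite eqxx.
rewrite -add1n -(cards1 u).
refine (maximum_pair_extend sym irr alpha2 mAB l1 (Y := Z :\: N) _ _ _ _).
- move=> x /set1P->; split; [move/(subsetP sQ): uQ | move/(subsetP sQ): vQ].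
    by rewrite inE.
  by rewrite inE.
- by move=> y; rewrite in_setD in_setD in_setC => /and3P[].
- move=> x y /set1P-> yZN; have yZ : y \in Z by move: yZN; rewrite inE => /andP[].
  split.
  + by apply: contraNneq uZ => ->.
  + by apply: contraNneq vZ => ->.
  + move: yZN; rewrite in_setD inE yZ /= => /andP[].
    by rewrite negb_and !negbK.
- have sNZ : N \subset Z by apply/subsetP => y; rewrite inE => /andP[].
  have s2 : [set u; v] \subset ~: (A :|: B) by rewrite -defQ.
  rewrite cardsD (setIidPr sNZ) /Z cardsD (setIidPr s2) cards2 uv; lia.
Qed.

(* A vertex missing two of the u_i is bad for at most one of the two perfect
   matchings of the hexagon u0 ... u5, so the bad sets of the two matchings
   have total size at most 2/3 of the sum of the non-degrees of the u_i. *)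
Lemma maximum_pair_cm3 (A B : {set T}) :
  maximum_pair e A B -> 21 + #|A| + #|B| <= #|T| ->
  4 * (#|A| + #|B|) + 4 <= #|T| -> #|A| + #|B| + 3 <= cm e.
Proof.
move=> mAB leT21 leT4; have [/and4P[dAB _ _ _] _] := mAB.
have cAB : #|A :|: B| = #|A| + #|B|.
  by rewrite cardsU (disjoint_setI0 dAB) cards0 subn0.
have cR := cardsC (A :|: B).
(* The 21 in the hypothesis is 6 * 7 / 2, the Ramsey bound for a 6-clique. *)
have [|Q sQ [clQ cQ]] :=
  ramsey3 sym irr alpha2 (k := 6) (X := ~: (A :|: B)); first by lia.
have := enum_uniq Q; have memQ := mem_enum Q.
have : size (enum Q) = 6 by rewrite -cardE.
case: (enum Q) memQ => [|u0 [|u1 [|u2 [|u3 [|u4 [|u5 [|? ?]]]]]]] //= memQ _ Uq.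
pose Z := ~: (A :|: B) :\: Q.
pose U := [set y in Z | [|| ~~ e u0 y && ~~ e u1 y, ~~ e u2 y && ~~ e u3 y | ~~ e u4 y && ~~ e u5 y]].
pose U' := [set y in Z | [|| ~~ e u1 y && ~~ e u2 y, ~~ e u3 y && ~~ e u4 y | ~~ e u5 y && ~~ e u0 y]].
have extend a a' b b' c c' V :
  uniq [:: a; a'; b; b'; c; c'] -> [:: a; a'; b; b'; c; c'] =i Q ->
  V = [set y in Z | [|| ~~ e a y && ~~ e a' y, ~~ e b y && ~~ e b' y | ~~ e c y && ~~ e c' y]] ->
  #|V| <= 2 * (#|A| + #|B|).-1 -> #|A| + #|B| + 3 <= cm e.
  move=> Us memq defV leV.
  have [D [f [lD cD Df]]] : exists D f, [/\ linked e D f, #|D| = 3 &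
    {in D, forall x, (x, f x) \in [:: (a, a'); (b, b'); (c, c')]}].
    by apply: (linked3 clQ Us) => x; rewrite memq.
  have DQ x : x \in D -> x \in Q /\ f x \in Q.
    by move/Df; rewrite !inE => /or3P[] /eqP[-> ->]; rewrite -!memq !inE !eqxx ?orbT.
  have sVZ : V \subset Z by rewrite defV; apply/subsetP => y; rewrite inE => /andP[].
  rewrite addnC -cD.
  refine (maximum_pair_extend sym irr alpha2 mAB lD (Y := Z :\: V) _ _ _ _).
  - by move=> x /DQ[/(subsetP sQ) + /(subsetP sQ)]; rewrite !in_setC.
  - by move=> y; rewrite in_setD in_setD in_setC => /and3P[].
  - move=> x y xD; rewrite in_setD => /andP[yV yZ].
    have yQ : y \notin Q by move: yZ; rewrite in_setD => /andP[].
    have [xQ fxQ] := DQ x xD; split.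
    + by apply: contraNneq yQ => <-.
    + by apply: contraNneq yQ => <-.
    + move: yV; rewrite defV inE yZ /= !negb_or !negb_and !negbK => /and3P[h1 h2 h3].
      by have := Df x xD; rewrite !inE => /or3P[] /eqP[-> ->].
  (* With m = [#|A| + #|B|], at least [#|T|] - m - 6 - 2(m - 1) vertices remain, which is at least m
     exactly when 4m + 4 <= [#|T|]. *)
  - rewrite cardsD (setIidPr sVZ) /Z cardsD (setIidPr sQ) cQ; lia.
have cardZ P : #|[set y in Z | P y]| = \sum_(y in Z) (P y : nat).
  by rewrite -sum1_card big_mkcond [RHS]big_mkcond; apply: eq_bigr => y _;
     rewrite inE; case: (y \in Z) => //=; case: (P y).
have notZ u : u \in Q -> u \notin Z by move=> uQ; rewrite in_setD uQ.
have dQ u : u \in [:: u0; u1; u2; u3; u4; u5] ->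
    #|[set y in Z | ~~ e u y]| < #|A| + #|B|.
  by rewrite memQ => uQ; apply: card_nonnbrs mAB (notZ u uQ).
have leUU : 3 * (#|U| + #|U'|) <=
    2 * (#|[set y in Z | ~~ e u0 y]| + #|[set y in Z | ~~ e u1 y]| +
         #|[set y in Z | ~~ e u2 y]| + #|[set y in Z | ~~ e u3 y]| +
         #|[set y in Z | ~~ e u4 y]| + #|[set y in Z | ~~ e u5 y]|).
  (* Checked vertex by vertex: lying in one bad set means missing at least two of the six, lying in
     both at least three. *)
  rewrite !cardZ -!big_split /= !big_distrr /=; apply: leq_sum => y _.
  by case: (e u0 y); case: (e u1 y); case: (e u2 y); case: (e u3 y);
     case: (e u4 y); case: (e u5 y).
have d u i : nth u [:: u0; u1; u2; u3; u4; u5] i = u -> i < 6 ->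
    #|[set y in Z | ~~ e u y]| < #|A| + #|B|.
  by move=> <- lti; apply: dQ; apply: mem_nth.
have d0 := d u0 0 erefl isT; have d1 := d u1 1 erefl isT.
have d2 := d u2 2 erefl isT; have d3 := d u3 3 erefl isT.
have d4 := d u4 4 erefl isT; have d5 := d u5 5 erefl isT.
have [leU|ltU] := leqP #|U| (2 * (#|A| + #|B|).-1).
  exact: (extend u0 u1 u2 u3 u4 u5 U).
(* The second perfect matching is the first read from a rotated hexagon. *)
apply: (extend u1 u2 u3 u4 u5 u0 U') => //; last by lia.
  by rewrite -(rot_uniq 5).
by move=> x; rewrite -memQ -(mem_rot 5).
Qed.

Lemma exists_maximum_pair (S1 S2 : {set T}) :
  clique_pair e S1 S2 ->
  exists A B, maximum_pair e A B /\ #|S1| + #|S2| <= #|A| + #|B|.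
Proof.
move=> cS.
case: (@arg_maxnP _ (S1, S2) (fun p => clique_pair e p.1 p.2)
  (fun p => #|p.1| + #|p.2|) cS) => -[A B] /= cAB maxAB.
exists A, B; split; last exact: (maxAB (S1, S2)).
by split=> // A' B' cAB'; apply: (maxAB (A', B')).
Qed.
End LargePairs.

Theorem theorem1p4 (t : nat) (T : finType) (e : rel T) :
  0 < t -> simple_graph e ->
  #|T| = 4 * t - 1 -> alpha e = 2 -> cm e <= t - 1 ->
  (forall t' : nat, 0 < t' -> t' < t -> conjecture t') ->
  forall S1 S2 : {set T}, [disjoint S1 & S2] ->
    clique e S1 -> clique e S2 -> anticomplete e S1 S2 ->
    ((#|S1| + #|S2|)%:Z <= t%:Z - 4)%R.
Proof.
move=> t_gt0 [sym irr] cT alphaE cm_lt _ S1 S2 dS cl1 cl2 acS.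
have alpha2 : alpha e <= 2 by rewrite alphaE.
have cS : clique_pair e S1 S2 by apply/and4P.
have [A [B [mAB leS]]] := exists_maximum_pair cS.
have [/and4P[_ clA clB _] maxAB] := mAB.
(* The additive form in [nat] matches the untruncated integer bound, which is negative for t < 4. *)
suff : #|A| + #|B| + 4 <= t by lia.
rewrite leqNgt; apply/negP => ltAB.
(* This bounds [#|A| + #|B|] by 2t - 2, leaving enough outside vertices for [maximum_pair_cm]. *)
have clique_lt C : clique e C -> #|C| < t.
  move=> clC; rewrite ltnNge; apply/negP => leC.
  have leT : 4 * t - 1 <= #|T| by rewrite cT.
  by have := clique_cm sym irr alpha2 leT clC leC; lia.
have ltA := clique_lt A clA; have ltB := clique_lt B clB.
have lt0 : #|A| + #|B| < t.
  have := maximum_pair_cm sym irr alpha2 mAB; lia.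
have lt1 : #|A| + #|B| < t.-1.
  have := maximum_pair_cm1 sym irr alpha2 mAB; lia.
(* For t <= 8, t(t - 1) <= 2(4t - 1), so there is a clique of size t - 1; paired with the empty set
   it contradicts [lt1]. *)
have t_ge9 : 9 <= t.
  rewrite leqNgt; apply/negP => lt9.
  have [|Q _ [clQ cQ]] := ramsey3 sym irr alpha2 (k := t.-1) (X := setT).
    rewrite cardsT cT; nia.
  have := maxAB Q set0; rewrite cards0 cQ.
  have -> : clique_pair e Q set0.
    apply/and4P; split=> //.
    - by rewrite -setI_eq0 setI0.
    - by apply/cliqueP => x y; rewrite inE.
    - by apply/anticompleteP => x y _; rewrite inE.
  by move/(_ isT); lia.
(* Only the totals t - 3 and t - 2 are left, and three extra edges bring [cm e] to at least t. *)
have := maximum_pair_cm3 sym irr alpha2 mAB; lia.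
Qed.
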